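(* Let $\ell$ be a prime and let $v$ be a positive integer. Then there exists a positive integer $w$ such that, for every $\alpha \in \mathbb{Q}$ with $\operatorname{ord}_{\ell}(\alpha-2) = v+w$ and every $r \in \mathbb{Z}$ with $\operatorname{ord}_{\ell}(12r+1) = w$, we have for all integers $n$ that $$p_{\alpha}(\ell^{w+1} n + r) \equiv 0 \pmod{\ell^v}.$$
   Context: For $\alpha \in \mathbb{Q}$, the rational numbers $p_\alpha(n)$ are defined by the formal power series identity $\sum_{n=0}^{\infty} p_\alpha(n) q^n = (q;q)_\infty^{\alpha}$, where $(q;q)_\infty = \prod_{n=1}^\infty (1-q^n)$ (the power is the one with constant term $1$), and $p_\alpha(n) := 0$ for $n<0$. If $\alpha = a/b$ in lowest terms with $b>0$, then for a prime $\ell \nmid b$ the numbers $p_\alpha(n)$ are $\ell$-integral (i.e. lie in $\mathbb{Z}_{(\ell)}$). For a prime $\ell$, $\operatorname{ord}_\ell$ denotes the $\ell$-adic valuation on $\mathbb{Q}$, and for an $\ell$-integral rational $x$, $x \equiv 0 \pmod{\ell^m}$ means $\operatorname{ord}_\ell(x) \ge m$. *)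

(* Defs.v *)
From HB Require Import structures.
From mathcomp Require Import all_boot all_order all_algebra.
From mathcomp Require Import constructive_ereal.
Set Implicit Arguments.
Unset Strict Implicit.
Unset Printing Implicit Defensive.
Import Order.TTheory GRing.Theory Num.Theory.
Local Open Scope ring_scope.

(* The l-adic valuation on the rationals (meaningful for l prime), with value
   +oo at 0. *)
Definition ordq (l : nat) (x : rat) : \bar int :=
  if x == 0 then +oo%E
  else ((logn l `|numq x|%N)%:Z - (logn l `|denq x|%N)%:Z)%:E.

Definition gbinom (a : rat) (k : nat) : rat :=
  (\prod_(i < k) (a - i%:R)) / k`!%:R.

(* A formal power series over rat is represented by its coefficient sequence.
   The series is f ^ a = \sum_k gbinom a k * (f - 1) ^ k, for f of constant
   term 1. As (f - 1) ^ k then has no term of degree < k, the coefficient of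
   degree n only involves k <= n and f modulo X^(n+1). *)
Definition series_pow (f : nat -> rat) (a : rat) (n : nat) : rat :=
  (\sum_(k < n.+1) gbinom a k *: (\poly_(i < n.+1) f i - 1) ^+ k)`_n.

(* The factors 1 - X^k with k > n of the infinite product (q; q)_oo do not
   contribute to the coefficient of degree n. *)
Definition euler_series (n : nat) : rat :=
  (\prod_(1 <= k < n.+1) (1 - 'X^k) : {poly rat})`_n.

Definition p_ (alpha : rat) (n : int) : rat :=
  if n is Posz m then series_pow euler_series alpha m else 0.

(* Main.v *)
Require Import Defs.
From HB Require Import structures.
From mathcomp Require Import all_boot all_order all_algebra all_field.
From mathcomp Require Import constructive_ereal.
From mathcomp Require Import zify ring.
Set Implicit Arguments.
Unset Strict Implicit.
Unset Printing Implicit Defensive.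
Import Order.TTheory GRing.Theory Num.Theory.
Local Open Scope ring_scope.

(** Write alpha = 2 + l^(v+w) beta with beta an l-adic unit, so that
    (q;q)^alpha = (q;q)^2 * G with G = ((q;q)^beta)^(l^(v+w)).

    - The factor G only matters at exponents divisible by l^(w+1). Indeed
      q G' is divisible by l^(v+w), that is, l^(v+w) divides j G_j for all j;
      if l^(w+1) does not divide j, this leaves l^v | G_j
      ([dvdz_coef_pow]).

    - Therefore the coefficient of degree N = l^(w+1) n + r of (q;q)^alpha is,
      modulo l^v, a combination of coefficients of degree M of (q;q)^2 with
      M = N mod l^(w+1), and for these 12 M + 1 has valuation exactly w.

    - By the pentagonal number theorem ([pentagonal]), 4 times the coefficient
      of degree M of (q;q)^2 is [theta2 (12 M + 1)], where [theta2 m] is the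
      sum of (12/x)(12/y) over the integer points of x^2 + y^2 = 2 m
      ([coef_theta_trunc_sqr]).

    - That sum satisfies a Hecke relation: with theta2 (m / l) read as 0 when
      l does not divide m, theta2 (l m) = c theta2 m - s theta2 (m / l), where
      either c = 0, or s = 1 and c = 2 or -2. For l = 3 mod 4, l divides both
      coordinates of each point of the circle for l m. For
      l = a^2 + b^2, these points are the multiples by a + i b or by a - i b
      of the points of the circle for m, and the ones that are both are the
      multiples by l of the points of the circle for m / l ([hecke_split]).
      How (12/x)(12/y) changes under multiplication by a + i b only depends
      on residues mod 12, and is found by inspecting them.

    - Consequently, if l does not divide m, theta2 (l^w m) is zero for odd w,
      or it is (w+1) theta2 m up to sign. The choice w = 2 l^v - 1 makes it
      divisible by l^v in both cases.

    The primes 2 and 3 never divide 12 r + 1. Rational exponents are reduced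
    to natural ones by continuity: the coefficients of (q;q)^alpha are
    polynomials in alpha, and alpha is an l-adic limit of natural numbers
    2 + l^(v+w) B. *)

(** * Primes that are sums of two squares *)

Lemma expf_pred_Fp (l : nat) (l_prime : prime l) (x : 'F_l) :
  x != 0 -> x ^+ l.-1 = 1.
Proof.
move=> x0; have h := expf_card x; rewrite card_Fp // in h.
by apply: (mulfI x0); rewrite mulr1 -exprS prednK ?prime_gt0.
Qed.

Lemma prime_neq_sqr (l m : nat) : prime l -> (m ^ 2)%N <> l.
Proof.
move=> l_prime lE; move: l_prime; rewrite -lE; case: m lE => [|[|m]] //= lE.
by move/primeP => [_ /(_ m.+2)]; rewrite dvdn_exp // => /(_ isT); lia.
Qed.

(** Half of the nonzero residues x mod l satisfy x^((l-1)/2) = -1, and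
    (l-1)/2 is even. *)
Lemma sqrt_opp1_Fp (l : nat) (l_prime : prime l) (l14 : (l %% 4 = 1)%N) :
  exists s : 'F_l, s ^+ 2 = -1.
Proof.
have l_odd : (2 < l)%N by have := prime_gt1 l_prime; lia.
pose k := (l.-1)./2.
have lE : l = (k.*2).+1 by rewrite /k; lia.
have kE : k = (k./2).*2 by lia.
have cardF : #|'F_l| = l by apply: card_Fp.
have fermat (x : 'F_l) : x != 0 -> x ^+ (k.*2) = 1.
  have <- : l.-1 = k.*2 by lia.
  exact: expf_pred_Fp.
have [/existsP [x /andP[x0 xk]] | none] :=
  boolP [exists x : 'F_l, (x != 0) && (x ^+ k != 1)].
- exists (x ^+ (k./2)); rewrite -exprM muln2 -kE.
  have : (x ^+ k - 1) * (x ^+ k + 1) = 0.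
    by rewrite -subr_sqr expr1n -exprM muln2 fermat // subrr.
  move/eqP; rewrite mulf_eq0 subr_eq0 (negbTE xk) /= addr_eq0 => /eqP; done.
exfalso.
(* Otherwise X^k - 1 vanishes at the 2 k nonzero residues. *)
pose rs := [seq x <- enum 'F_l | x != 0].
have k0 : (0 < k)%N by lia.
have p0 : ('X^k - 1%:P : {poly 'F_l}) != 0.
  by rewrite -size_poly_eq0 size_XnsubC.
have rroot : all (root ('X^k - 1%:P : {poly 'F_l})) rs.
  apply/allP => x; rewrite mem_filter => /andP[x0 _].
  rewrite rootE !hornerE subr_eq0.
  by move/existsPn: none => /(_ x); rewrite x0 /= negbK.
have := max_poly_roots p0 rroot (filter_uniq _ (enum_uniq _)).
rewrite size_XnsubC // size_filter.
have := count_predC (fun x : 'F_l => x != 0) (enum 'F_l).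
rewrite -cardE cardF.
rewrite (_ : count (predC _) _ = count_mem (0 : 'F_l) (enum 'F_l)); last first.
  by apply: eq_count => x /=; rewrite negbK.
rewrite count_uniq_mem ?enum_uniq // mem_enum /=; set cnt := count _ _; lia.
Qed.

(** Thue's argument: with s^2 = -1 mod l, two of the more than l pairs (x, y)
    with 0 <= x, y <= sqrt l have the same x - s y. Their difference (a, b)
    satisfies a^2 + b^2 = 0 mod l and 0 < a^2 + b^2 < 2 l. *)
Lemma prime_sum_two_squares (l : nat) (l_prime : prime l)
    (l14 : (l %% 4 = 1)%N) :
  exists a b : int, a ^+ 2 + b ^+ 2 = l%:Z.
Proof.
have [s s2] := sqrt_opp1_Fp l_prime l14.
have [k kl lk] : exists2 k, (k ^ 2 < l)%N & (l < k.+1 ^ 2)%N.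
  have ex : exists k, (l < k.+1 ^ 2)%N by exists l; nia.
  case: (ex_minnP ex) => k lk kmin.
  exists k => //; case: k kmin {lk} => [|k] kmin; first by lia.
  rewrite ltn_neqAle; apply/andP; split; first by apply/eqP/prime_neq_sqr.
  by rewrite leqNgt; apply/negP => /kmin; lia.
pose f (u : 'I_k.+1 * 'I_k.+1) : 'F_l := (u.1 : nat)%:R - s * (u.2 : nat)%:R.
have : ~~ injectiveb f.
  apply/negP => /injectiveP /leq_card.
  have -> : #|'F_l| = l by apply: card_Fp.
  by rewrite card_prod !card_ord; nia.
case/injectivePn => u [u' uu' fu].
pose a : int := (u.1 : nat)%:Z - (u'.1 : nat)%:Z.
pose b : int := (u.2 : nat)%:Z - (u'.2 : nat)%:Z.
have ab : a%:~R = s * b%:~R :> 'F_l.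
  by rewrite /a /b !rmorphB /= mulrBr -!pmulrn; move: fu; rewrite /f => /eqP;
    rewrite subr_eq => /eqP ->; ring.
have ldvd : (l%:Z %| a ^+ 2 + b ^+ 2)%Z.
  rewrite (dvdz_pcharf (pchar_Fp l_prime)) rmorphD !rmorphXn /= ab exprMn s2.
  by apply/eqP; ring.
have ab0 : (a != 0) || (b != 0).
  case: eqP => //= a0; apply/eqP => b0; case/negP: uu'; apply/eqP.
  rewrite (surjective_pairing u) (surjective_pairing u').
  by congr (_, _); apply: val_inj => /=;
    [move/eqP: a0 | move/eqP: b0]; rewrite subr_eq0 => /eqP [].
exists a, b; case/dvdzP: ldvd => q qE.
have aB : `|a| <= k%:Z.
  by have := ltn_ord u.1; have := ltn_ord u'.1; rewrite /a; lia.
have bB : `|b| <= k%:Z.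
  by have := ltn_ord u.2; have := ltn_ord u'.2; rewrite /b; lia.
have : 0 < a ^+ 2 + b ^+ 2 by case/orP: ab0 => h; nia.
have : a ^+ 2 + b ^+ 2 < 2 * l%:Z by nia.
rewrite qE => h1 h2.
have l0 : 0 < l%:Z by lia.
have -> : q = 1 by clear -h1 h2 l0; nia.
by rewrite mul1r.
Qed.

(** * Euler's pentagonal number theorem *)

(** The Kronecker symbol (12 / x). *)
Definition kron12 (x : int) : int :=
  match `|(x %% 12)%Z|%N with
  | 1 | 11 => 1
  | 5 | 7 => -1
  | _ => 0
  end.

Definition euler_prod (m n : nat) : {poly int} :=
  \prod_(m <= k < n) (1 - 'X^k).

Definition tri (k : nat) : nat := 'C(k.+1, 2).

Lemma triS k : tri k.+1 = (k.+1 + tri k)%N.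
Proof. by rewrite /tri binS bin1 addnC. Qed.

Lemma tri2 k : (tri k).*2 = (k * k.+1)%N.
Proof. by elim: k => [|k IH] //; rewrite triS; lia. Qed.

(** Shanks' finite form of the pentagonal number theorem: this sum agrees with
    the Euler product up to degree n, since its terms with k > 0 have no
    monomial of degree at most n, and it telescopes in n to a theta series. *)
Definition shanks_sum (n : nat) : {poly int} :=
  \sum_(k < n.+1) (-1) ^+ k * euler_prod k.+1 n.+1 * 'X^(n * k + tri k).

(** The new factor 1 - X^(n+1) of each product splits the sum for n+1 into two
    sums; after a shift of the index by one, the factors 1 - X^(k+1) absorbed
    in the products make everything cancel but the sum for n and two
    monomials. *)
Lemma shanks_sum_step n :
  shanks_sum n.+1 = shanks_sum n + (-1) ^+ n.+1 *
    ('X^(n.+1 ^ 2 + tri n) + 'X^(n.+1 ^ 2 + tri n.+1)).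
Proof.
pose c k : {poly int} := (-1) ^+ k * euler_prod k.+1 n.+1.
have prodS k : (k <= n)%N ->
    euler_prod k.+1 n.+2 = euler_prod k.+1 n.+1 * (1 - 'X^(n.+1)).
  by move=> kn; rewrite /euler_prod big_nat_recr.
have cS k : (k < n)%N -> c k = - c k.+1 * (1 - 'X^(k.+1)).
  by move=> kn; rewrite /c /euler_prod big_ltn // (exprS (-1)); ring.
have cn : c n = (-1) ^+ n by rewrite /c /euler_prod big_geq // mulr1.
rewrite {1}/shanks_sum big_ord_recr /= /euler_prod big_geq // mulr1.
rewrite (eq_bigr (fun k : 'I_n.+1 =>
   c k * 'X^(n.+1 * k + tri k) - c k * 'X^(n.+1 * k.+1 + tri k))); last first.
  move=> k _; rewrite -/(euler_prod _ _) prodS ?leq_ord // /c.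
  by rewrite mulnS addnCA !exprD; ring.
rewrite sumrB.
rewrite [X in _ - X]big_ord_recr /= cn.
rewrite big_ord_recl /= [in RHS]/shanks_sum big_ord_recl /= -/(c 0%N).
rewrite (eq_bigr (fun k : 'I_n =>
    (-1) ^+ k.+1 * euler_prod k.+2 n.+1 * 'X^(n * k.+1 + tri k.+1) +
    c k * 'X^(n.+1 * k.+1 + tri k))); last first.
  move=> k _; rewrite /bump /= add1n (cS k) // -/(c k.+1).
  rewrite (_ : n.+1 * k.+1 + tri k.+1 = n * k.+1 + tri k.+1 + k.+1)%N; last lia.
  rewrite (_ : n.+1 * k.+1 + tri k = n * k.+1 + tri k.+1)%N; last first.
    by rewrite triS; lia.
  by rewrite exprD; ring.
rewrite big_split /= !muln0 -!mulnn !(exprS (-1)).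
ring.
Qed.

Lemma kron12_mod (x : int) : kron12 (x %% 12)%Z = kron12 x.
Proof. by rewrite /kron12 modz_mod. Qed.

Lemma kron12D12 (x : int) (k : int) : kron12 (k * 12 + x) = kron12 x.
Proof. by rewrite /kron12 modzMDl. Qed.

Lemma kron12_6D (n c : nat) :
  kron12 (6 * n + c)%N = kron12 (6 * odd n + c)%N.
Proof.
rewrite -{1}(odd_double_half n).
rewrite (_ : (6 * _ + c)%N%:Z = (n./2)%:Z * 12 + (6 * odd n + c)%N%:Z).
  by rewrite kron12D12.
lia.
Qed.

(** The theta series of (12 / x): as x^2 = 24 i + 1 when (12 / x) is nonzero,
    the exponent is the pentagonal number (x^2 - 1) / 24. The bound 6 n + 1
    is the largest x that gives the n-th pair of pentagonal numbers. *)
Definition theta_trunc (n : nat) : {poly int} :=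
  \sum_(0 <= x < (6 * n).+2) kron12 x *: 'X^(x ^ 2 %/ 24).

Lemma shanks_sum_theta n : shanks_sum n = theta_trunc n.
Proof.
elim: n => [|n IH].
  rewrite /shanks_sum /theta_trunc big_ord1 /euler_prod big_geq //.
  rewrite 2?big_nat_recr //= big_geq // !scale0r !add0r scale1r.
  by rewrite !expr0 !mul1r.
rewrite shanks_sum_step IH; set th := theta_trunc n; rewrite /theta_trunc.
(* Of the six new values of x, only 6 n + 5 and 6 n + 7 are prime to 6. *)
rewrite (_ : (6 * n.+1).+2 = ((6 * n).+2).+4.+2); last lia.
rewrite 6?big_nat_recr //= -/(theta_trunc n) -/th.
have kE c : kron12 (iter c S (6 * n)) = kron12 (6 * odd n + c)%N.
  by rewrite -kron12_6D addnC; congr kron12; congr Posz; elim: c => //= c ->.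
have k2 : kron12 (6 * n).+2 = _ := kE 2%N.
have k3 : kron12 (6 * n).+3 = _ := kE 3%N.
have k4 : kron12 (6 * n).+4 = _ := kE 4%N.
have k5 : kron12 (6 * n).+1.+4 = _ := kE 5%N.
have k6 : kron12 (6 * n).+2.+4 = _ := kE 6%N.
have k7 : kron12 (6 * n).+3.+4 = _ := kE 7%N.
rewrite k2 k3 k4 k5 k6 k7.
rewrite (_ : ((6 * n).+1.+4 ^ 2 %/ 24 = n.+1 ^ 2 + tri n)%N); last first.
  have := tri2 n; nia.
rewrite (_ : ((6 * n).+3.+4 ^ 2 %/ 24 = n.+1 ^ 2 + tri n.+1)%N); last first.
  have := tri2 n.+1; nia.
rewrite exprS -signr_odd.
by case: (odd n); rewrite ?muln1 ?muln0 /= /kron12 /=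
  ?scale0r ?scale1r ?scaleN1r; ring.
Qed.

Lemma coef_euler_prod_trunc N i : (i <= N)%N ->
  (euler_prod 1 N.+1)`_i = (euler_prod 1 i.+1)`_i.
Proof.
elim: N => [|N IH]; first by case: i.
rewrite leq_eqVlt => /orP [/eqP -> //|iN].
rewrite /euler_prod big_nat_recr //= -/(euler_prod _ _).
by rewrite mulrBr mulr1 coefB coefMXn iN subr0 IH.
Qed.

Lemma coef_shanks_sum N i : (i <= N)%N ->
  (shanks_sum N)`_i = (euler_prod 1 N.+1)`_i.
Proof.
move=> iN; rewrite /shanks_sum big_ord_recl /= muln0 expr0 mulr1 mul1r coefD.
rewrite coef_sum big1 ?addr0 // => k _; rewrite coefMXn ifT // /bump /= add1n.
by rewrite triS; nia.
Qed.

Theorem pentagonal N i : (i <= N)%N ->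
  (euler_prod 1 i.+1)`_i = (theta_trunc N)`_i.
Proof.
move=> iN; rewrite -(coef_euler_prod_trunc iN) -coef_shanks_sum //.
by rewrite shanks_sum_theta.
Qed.

(** * The square of the Euler series as a binary theta series *)

Definition int_range (B : nat) : seq int :=
  [seq Posz i | i <- iota 0 B.+1] ++ [seq Negz i | i <- iota 0 B].

Lemma mem_int_range B x : (x \in int_range B) = (`|x| <= B)%N.
Proof.
rewrite mem_cat; case: x => n.
  rewrite mem_map ?mem_iota; last by move=> ? ? [].
  by rewrite orbC; case: mapP => [[y _] //|_] /=; lia.
rewrite [X in _ || X]mem_map ?mem_iota; last by move=> ? ? [].
by case: mapP => [[y _] //|_] /=; lia.
Qed.

Lemma int_range_uniq B : uniq (int_range B).
Proof.
rewrite cat_uniq !map_inj_uniq ?iota_uniq /=; try by move=> ? ? [].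
by rewrite andbT; apply/hasPn => _ /mapP [i _ ->]; apply/mapP => -[].
Qed.

Definition residues12 : seq int := [seq Posz i | i <- iota 0 12].

Lemma modz12_residue x : (x %% 12)%Z \in residues12.
Proof.
have := modz_ge0 x (isT : 12 != 0 :> int).
have := ltz_pmod x (isT : 0 < 12 :> int).
case: (x %% 12)%Z => // n n12 _.
by rewrite mem_map ?mem_iota //; move=> ? ? [].
Qed.

Lemma kron12N x : kron12 (- x) = kron12 x.
Proof.
have chk : all (fun y => kron12 (- y) == kron12 y) residues12 by [].
rewrite -(kron12_mod (- x)) -modzNm kron12_mod -(kron12_mod x).
exact/eqP/(allP chk)/modz12_residue.
Qed.

Lemma kron12_neq0 x : kron12 x != 0 ->
  [\/ (x %% 12)%Z = 1, (x %% 12)%Z = 5, (x %% 12)%Z = 7 | (x %% 12)%Z = 11].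
Proof.
rewrite /kron12; have := modz_ge0 x (isT : 12 != 0 :> int).
by case: (x %% 12)%Z => // - [|[|[|[|[|[|[|[|[|[|[|[|n]]]]]]]]]]]] //= _ _;
  [constructor 1 | constructor 2 | constructor 3 | constructor 4].
Qed.

Lemma kron12_neq0_sqr x : kron12 x != 0 ->
  x ^+ 2 = 24 * (`|x| ^ 2 %/ 24)%N%:Z + 1.
Proof.
move=> /kron12_neq0 xP.
have : (`|x| %% 12 = 1 \/ `|x| %% 12 = 5 \/ `|x| %% 12 = 7 \/
        `|x| %% 12 = 11)%N.
  by case: xP; lia.
rewrite -[x ^+ 2]ger0_norm ?sqr_ge0 // normrX -abszE {xP}; move: `|x|%N => y yP.
rewrite (divn_eq y 12); move: (y %/ 12)%N => q.
have sqE c : ((q * 12 + c) ^ 2 = 24 * (6 * q ^ 2 + q * c) + c ^ 2)%N by ring.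
by case: yP => [|[|[|]]] ->; rewrite sqE -PoszM; lia.
Qed.

Definition box (B : nat) : seq (int * int) :=
  [seq (x, y) | x <- int_range B, y <- int_range B].

Lemma mem_box B z : (z \in box B) = (`|z.1| <= B)%N && (`|z.2| <= B)%N.
Proof.
rewrite -!mem_int_range; apply/allpairsP/andP => [[p [p1 p2 ->]] // | [z1 z2]].
by exists z; split=> //; apply: surjective_pairing.
Qed.

Lemma box_uniq B : uniq (box B).
Proof.
by rewrite allpairs_uniq ?int_range_uniq // => -[? ?] [? ?] _ _ [-> ->].
Qed.

Definition circle (m : nat) : seq (int * int) :=
  [seq z <- box (2 * m) | z.1 ^+ 2 + z.2 ^+ 2 == (2 * m)%N%:Z].

Lemma circle_uniq m : uniq (circle m).
Proof. by rewrite filter_uniq ?box_uniq. Qed.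

Lemma mem_circle m z : (z \in circle m) = (z.1 ^+ 2 + z.2 ^+ 2 == (2 * m)%N%:Z).
Proof.
rewrite mem_filter mem_box; case: z => x y; rewrite [_.1]/= [_.2]/=.
by case: eqP => //= xyE; nia.
Qed.

Definition kron12_pair (z : int * int) : int := kron12 z.1 * kron12 z.2.

(** For m = 1 mod 12 this is 4 times the coefficient of q^m in eta(12 z)^2. *)
Definition theta2 (m : nat) : int := \sum_(z <- circle m) kron12_pair z.

Lemma theta_trunc_symm N :
  theta_trunc N *+ 2 =
  \sum_(x <- int_range (6 * N).+1) kron12 x *: 'X^(`|x|%N ^ 2 %/ 24).
Proof.
rewrite /int_range big_cat !big_map /= mulr2n /theta_trunc /index_iota subn0.
congr (_ + _); rewrite -[(6 * N).+2]add1n iotaD big_cat big_seq1 /=.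
rewrite scale0r add0r.
rewrite -[in LHS]/(iota 1 (6 * N).+1) -[in RHS]/(iota 0 (6 * N).+1).
rewrite (iotaDl 1 0) big_map; apply: eq_bigr => i _.
by rewrite NegzE kron12N.
Qed.

(** The signs of x and of y account for the factor 4. *)
Lemma coef_theta_trunc_sqr N M : (M <= N)%N ->
  (theta_trunc N ^+ 2)`_M *+ 4 = theta2 (12 * M).+1.
Proof.
move=> MN.
have -> : (theta_trunc N ^+ 2)`_M *+ 4 = ((theta_trunc N *+ 2) ^+ 2)`_M.
  rewrite -coefMn (_ : theta_trunc N ^+ 2 *+ 4 = (theta_trunc N *+ 2) ^+ 2) //.
  by ring.
(* x^2 + y^2 = 24 M + 2 < (6 N + 2)^2, so the box contains the circle. *)
set m := (12 * M).+1; rewrite theta_trunc_symm expr2.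
transitivity (\sum_(z <- box (6 * N).+1
    | z.1 ^+ 2 + z.2 ^+ 2 == (2 * m)%N%:Z) kron12_pair z).
  rewrite [RHS]big_mkcond big_allpairs mulr_suml coef_sum; apply: eq_bigr => x _.
  rewrite mulr_sumr coef_sum; apply: eq_bigr => y _ /=.
  rewrite -scalerAl -scalerAr -exprD !coefZ coefXn mulrA /kron12_pair /=.
  have [-> | x0] := eqVneq (kron12 x) 0; first by rewrite !mul0r; case: ifP.
  have [-> | y0] := eqVneq (kron12 y) 0; first by rewrite mulr0 mul0r; case: ifP.
  rewrite kron12_neq0_sqr // [y ^+ 2]kron12_neq0_sqr //.
  rewrite (_ : (_ == _ :> int) =
    (M == (`|x| ^ 2 %/ 24 + `|y| ^ 2 %/ 24)%N)); last first.
    by rewrite /m; lia.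
  by case: eqP; rewrite ?mulr1 ?mulr0.
rewrite -big_filter; apply: perm_big; apply: uniq_perm.
- by rewrite filter_uniq ?box_uniq.
- exact: circle_uniq.
move=> [x y]; rewrite mem_circle mem_filter mem_box [_.1]/= [_.2]/=.
by case: eqP => //= xyE; rewrite /m in xyE; nia.
Qed.

(** * The Hecke relation *)

(** Multiplication by a + i b on Gaussian integers. *)
Definition gmul (a b : int) (z : int * int) : int * int :=
  (a * z.1 - b * z.2, b * z.1 + a * z.2).

Lemma kron12M x y : kron12 (x * y) = kron12 x * kron12 y.
Proof.
have chk : all (fun x => all (fun y => kron12 (x * y) == kron12 x * kron12 y)
  residues12) residues12 by [].
rewrite -(kron12_mod (x * y)) -modzMm kron12_mod -(kron12_mod x) -(kron12_mod y).
exact/eqP/(allP (allP chk _ (modz12_residue x)))/modz12_residue.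
Qed.

Lemma kron12_pair_gmul_mod a b z :
  kron12_pair (gmul a b z) =
  kron12_pair (gmul (a %% 12)%Z (b %% 12)%Z ((z.1 %% 12)%Z, (z.2 %% 12)%Z)).
Proof.
rewrite /kron12_pair /=; congr (_ * _).
  rewrite -kron12_mod -[in RHS]kron12_mod; congr kron12.
  by rewrite -modzDm -modzNm -(modzMm a) -(modzMm b) modzNm modzDm.
rewrite -kron12_mod -[in RHS]kron12_mod; congr kron12.
by rewrite -modzDm -(modzMm a) -(modzMm b) modzDm.
Qed.

Definition conj_sum (a b x y : int) : int :=
  kron12_pair (gmul a b (x, y)) + kron12_pair (gmul a (- b) (x, y)).

Lemma conj_sum_mod a b x y :
  conj_sum a b x y = conj_sum (a %% 12)%Z (b %% 12)%Z (x %% 12)%Z (y %% 12)%Z.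
Proof.
rewrite /conj_sum; congr (_ + _); rewrite kron12_pair_gmul_mod //.
by rewrite [RHS]kron12_pair_gmul_mod /= !modz_mod modzNm.
Qed.

Lemma sqr_sum_mod12 a b (l : nat) : a ^+ 2 + b ^+ 2 = l%:Z ->
  (((a %% 12)%Z ^+ 2 + (b %% 12)%Z ^+ 2) %% 12)%Z = (l %% 12)%N.
Proof.
by move=> abE; rewrite -modz_nat -abE -modzDm !modzXm modzDm.
Qed.

(** Here a and b are prime to 3 and of opposite parity. If the values are not
    zero, then x and y are odd and 3 divides exactly one of them. Passing from
    a + i b to a - i b then changes the sign of exactly one coordinate mod 3,
    and of both coordinates or of none mod 4. *)
Lemma conj_sum_5mod12 (l : nat) a b x y :
  a ^+ 2 + b ^+ 2 = l%:Z -> (l %% 12 = 5)%N -> conj_sum a b x y = 0.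
Proof.
have chk : all (fun a => all (fun b =>
    (((a ^+ 2 + b ^+ 2) %% 12)%Z == 5) ==>
    all (fun x => all (fun y => conj_sum a b x y == 0) residues12) residues12)
  residues12) residues12 by vm_compute.
move=> /sqr_sum_mod12 abE l5; rewrite conj_sum_mod; rewrite l5 in abE.
have /implyP := allP (allP chk _ (modz12_residue a)) _ (modz12_residue b).
rewrite abE => /(_ isT) chk2.
exact/eqP/(allP (allP chk2 _ (modz12_residue x)))/modz12_residue.
Qed.

(** Here 3 divides exactly one of a and b, and so does 2. Multiplication by
    a + i b or a - i b preserves (12/x)(12/y) if the two divide the same one,
    and changes its sign otherwise. *)
Lemma conj_sum_1mod12 (l : nat) a b :
  a ^+ 2 + b ^+ 2 = l%:Z -> (l %% 12 = 1)%N ->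
  exists2 e : int, e ^+ 2 = 1 &
    forall x y, conj_sum a b x y = 2 * e * kron12_pair (x, y).
Proof.
have chk : all (fun a => all (fun b =>
    (((a ^+ 2 + b ^+ 2) %% 12)%Z == 1) ==>
    has (fun e => all (fun x => all (fun y =>
        conj_sum a b x y == 2 * e * kron12_pair (x, y)) residues12) residues12)
      [:: 1; -1])
  residues12) residues12 by vm_compute.
move=> /sqr_sum_mod12 abE l1; rewrite l1 in abE.
have /implyP := allP (allP chk _ (modz12_residue a)) _ (modz12_residue b).
rewrite abE => /(_ isT) /hasP [e eP chk2].
exists e; first by move: eP; rewrite !inE => /orP [] /eqP ->.
move=> x y; rewrite conj_sum_mod /kron12_pair /= -(kron12_mod x) -(kron12_mod y).
exact/eqP/(allP (allP chk2 _ (modz12_residue x)))/modz12_residue.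
Qed.

Lemma dvdz_prime_mul (l : nat) (m n : int) : prime l ->
  (l %| m * n)%Z = (l %| m)%Z || (l %| n)%Z.
Proof. by move=> l_prime; rewrite !dvdzE abszM /= Euclid_dvdM. Qed.

Lemma dvdz_prime_sqr (l : nat) (m : int) : prime l ->
  (l %| m ^+ 2)%Z = (l %| m)%Z.
Proof. by move=> l_prime; rewrite expr2 dvdz_prime_mul // orbb. Qed.

Section Hecke.

Variables (l : nat) (l_prime : prime l) (l_gt3 : (3 < l)%N).

Definition theta2_div (m : nat) : int :=
  if (l %| m)%N then theta2 (m %/ l) else 0.

Lemma l_mod12 : [\/ l %% 12 = 1, l %% 12 = 5, l %% 12 = 7 | l %% 12 = 11]%N.
Proof.
have l2 : ~~ (2 %| l)%N.
  by apply/negP => /(prime_nt_dvdP l_prime) => /(_ isT); lia.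
have l3 : ~~ (3 %| l)%N.
  by apply/negP => /(prime_nt_dvdP l_prime) => /(_ isT); lia.
have : (l %% 12 = 1 \/ l %% 12 = 5 \/ l %% 12 = 7 \/ l %% 12 = 11)%N by lia.
by case=> [|[|[|]]]; [constructor 1|constructor 2|constructor 3|constructor 4].
Qed.

Lemma dvdz_prime2 (m : int) : (l %| 2 * m)%Z = (l %| m)%Z.
Proof.
rewrite dvdz_prime_mul //; case: (boolP (l %| 2)%Z) => //.
by rewrite dvdzE /= => /dvdn_leq; lia.
Qed.

Lemma kron12_sqr_l : kron12 l ^+ 2 = 1.
Proof. by rewrite /kron12 modz_nat /=; case: l_mod12 => ->. Qed.

Lemma sum_circle_dvd (m : nat) :
  \sum_(z <- circle (l * m) | (l %| z.1)%Z && (l %| z.2)%Z) kron12_pair z =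
  theta2_div m.
Proof.
have l0 : l%:Z != 0 by have := prime_gt0 l_prime; lia.
rewrite -big_filter /theta2_div; case: ifPn => [/dvdnP [m' ->] | lm].
  rewrite mulnK ?prime_gt0 //.
  have lK : injective (fun z : int * int => (l%:Z * z.1, l%:Z * z.2)).
    by move=> [x y] [x' y'] [/(mulfI l0) -> /(mulfI l0) ->].
  transitivity (\sum_(z <- [seq (l%:Z * z.1, l%:Z * z.2) | z <- circle m'])
      kron12_pair z); last first.
    rewrite big_map; apply: eq_bigr => -[x y] _; rewrite /kron12_pair /= !kron12M.
    by rewrite mulrACA -expr2 kron12_sqr_l mul1r.
  apply: perm_big.
  apply: uniq_perm; first by rewrite filter_uniq ?circle_uniq.
    by rewrite map_inj_uniq ?circle_uniq.
  move=> [X Y]; rewrite mem_filter mem_circle /=.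
  apply/andP/mapP => [[/andP [/dvdzP [x ->] /dvdzP [y ->]] /eqP xyE] |
                      [[x y]]].
    exists (x, y); last by rewrite ![l%:Z * _]mulrC.
    rewrite mem_circle /=; apply/eqP/(mulfI l0)/(mulfI l0).
    move: xyE; rewrite !PoszM => xyE.
    transitivity ((x * l) ^+ 2 + (y * l) ^+ 2); first by ring.
    by rewrite xyE; ring.
  rewrite mem_circle /= => /eqP xyE [-> ->].
  rewrite !dvdz_mulr //; split => //; apply/eqP.
  transitivity (l%:Z ^+ 2 * (x ^+ 2 + y ^+ 2)); first by ring.
  by rewrite xyE !PoszM; ring.
rewrite (@eq_in_filter _ _ pred0) ?filter_pred0 ?big_nil // => -[X Y].
rewrite mem_circle /= => /eqP xyE; apply/negbTE; apply: contra lm.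
move=> /andP [/dvdzP [x xE] /dvdzP [y yE]].
suff : (l %| 2 * m%:Z)%Z by rewrite dvdz_prime2.
apply/dvdzP; exists (x ^+ 2 + y ^+ 2); apply: (mulfI l0).
transitivity ((x * l) ^+ 2 + (y * l) ^+ 2); last by ring.
by rewrite -xE -yE xyE !PoszM; ring.
Qed.

(** If l did not divide X, then -1 = (Y / X)^2 would be a square mod l. *)
Lemma hecke_inert (m : nat) : (l %% 4 = 3)%N -> theta2 (l * m) = theta2_div m.
Proof.
move=> l43; rewrite -sum_circle_dvd /theta2 big_seq [RHS]big_seq_cond.
apply: eq_bigl => -[X Y]; rewrite mem_circle /=; case: eqP => //= xyE.
have [k kodd lE] : exists2 k, odd k & l.-1 = k.*2.
  by exists (l.-1)./2; lia.
have XY : (X%:~R : 'F_l) ^+ 2 = - Y%:~R ^+ 2.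
  apply/eqP; rewrite -addr_eq0 -!rmorphXn -rmorphD /= xyE.
  by rewrite -(dvdz_pcharf (pchar_Fp l_prime)) mulnCA PoszM dvdz_mulr.
have fermat (x : 'F_l) : x != 0 -> x ^+ (k.*2) = 1.
  by rewrite -lE; apply: expf_pred_Fp.
have dvdE (x : int) : (l %| x)%Z = (x%:~R == 0 :> 'F_l).
  exact: dvdz_pcharf (pchar_Fp l_prime) x.
have neg1 : (1 : 'F_l) != -1.
  rewrite -subr_eq0 opprK -[1 + 1]/(2%:~R) -dvdE; apply/negP.
  by rewrite -[2]mulr1 dvdz_prime2 dvdzE /= dvdn1; lia.
have X0 : X%:~R == 0 :> 'F_l.
  apply/negPn/negP => X0; have := congr1 (fun x => x ^+ k) XY.
  rewrite /= exprNn -signr_odd kodd -!exprM !mul2n fermat // => h.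
  have Y0 : Y%:~R != 0 :> 'F_l.
    apply: contraNneq X0 => Y0; move/eqP: XY; rewrite Y0 expr0n oppr0.
    by rewrite expf_eq0.
  by move: neg1; rewrite {1}h fermat // expr1 mulr1 eqxx.
have Y0 : Y%:~R == 0 :> 'F_l.
  by move: XY; rewrite (eqP X0) expr0n => /eqP; rewrite eq_sym oppr_eq0 expf_eq0.
by rewrite !dvdE X0 Y0.
Qed.

(** Division by a + i b is multiplication by a - i b followed by division by l;
    divisibility of the real part a X + b Y of the product by l implies that
    of the imaginary part, as the norm l (X^2 + Y^2) is divisible by l. *)
Lemma sum_circle_gmul (m : nat) (a b : int) : a ^+ 2 + b ^+ 2 = l%:Z ->
  \sum_(z <- circle (l * m) | (l %| a * z.1 + b * z.2)%Z) kron12_pair z =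
  \sum_(u <- circle m) kron12_pair (gmul a b u).
Proof.
move=> abE; have l0 : l%:Z != 0 by have := prime_gt0 l_prime; lia.
rewrite -big_filter -(big_map (gmul a b) xpredT kron12_pair).
apply: perm_big; apply: uniq_perm.
- by rewrite filter_uniq ?circle_uniq.
- rewrite map_inj_uniq ?circle_uniq // => -[x y] [x' y'] [e1 e2].
  congr (_, _); apply: (mulfI l0); rewrite -abE.
    transitivity (a * (a * x - b * y) + b * (b * x + a * y)); first by ring.
    by rewrite e1 e2; ring.
  transitivity (a * (b * x + a * y) - b * (a * x - b * y)); first by ring.
  by rewrite e1 e2; ring.
move=> [X Y]; rewrite mem_filter mem_circle /=.
apply/andP/mapP => [[/dvdzP [x xE] /eqP XYE] | [[x y]]].
  have /dvdzP [y yE] : (l %| a * Y - b * X)%Z.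
    rewrite -(dvdz_prime_sqr _ l_prime).
    rewrite (_ : _ ^+ 2 = l%:Z * (X ^+ 2 + Y ^+ 2) - (a * X + b * Y) ^+ 2).
      apply: rpredB; first exact: dvdz_mulr.
      by rewrite [_ \in _](dvdz_prime_sqr _ l_prime) xE dvdz_mull.
    by rewrite -abE; ring.
  have X_E : X = a * x - b * y.
    apply: (mulfI l0); rewrite -{1}abE.
    transitivity (a * (a * X + b * Y) - b * (a * Y - b * X)); first by ring.
    by rewrite xE yE; ring.
  have Y_E : Y = b * x + a * y.
    apply: (mulfI l0); rewrite -{1}abE.
    transitivity (b * (a * X + b * Y) + a * (a * Y - b * X)); first by ring.
    by rewrite xE yE; ring.
  exists (x, y); last by rewrite /gmul /= -X_E -Y_E.
  rewrite mem_circle /=; apply/eqP/(mulfI l0).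
  rewrite -{1}abE; transitivity (X ^+ 2 + Y ^+ 2); first by rewrite X_E Y_E; ring.
  by rewrite XYE !PoszM; ring.
rewrite mem_circle /= => /eqP xyE [-> ->]; split.
  by apply/dvdzP; exists x; rewrite -abE; ring.
apply/eqP; transitivity ((a ^+ 2 + b ^+ 2) * (x ^+ 2 + y ^+ 2)); first by ring.
by rewrite abE xyE !PoszM; ring.
Qed.

(** Inclusion-exclusion on the circle for l m: each of its points is divisible
    by a + i b or by a - i b, because (a X + b Y)(a X - b Y) is 0 mod l, and
    those divisible by both are divisible by l. *)
Lemma hecke_split (m : nat) (a b : int) : a ^+ 2 + b ^+ 2 = l%:Z ->
  theta2 (l * m) = \sum_(u <- circle m) conj_sum a b u.1 u.2 - theta2_div m.
Proof.
move=> abE; have abE' : a ^+ 2 + (- b) ^+ 2 = l%:Z by rewrite sqrrN.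
have small (c : int) : c ^+ 2 <= l%:Z -> (l %| c)%Z -> c = 0.
  move=> c_le /dvdzP [q cE]; rewrite cE in c_le *.
  have [-> | q0] := eqVneq q 0; first by rewrite mul0r.
  exfalso; have : (1 <= q ^+ 2) by rewrite -gtz0_ge1 exprn_even_gt0 //=.
  by rewrite exprMn in c_le; nia.
have lnsq (c : int) : c ^+ 2 != l%:Z.
  apply/eqP => cE; have := congr1 absz cE; rewrite abszX /=.
  exact: prime_neq_sqr.
have la : ~~ (l %| a)%Z.
  apply/negP => /small a0; have := lnsq b; rewrite -abE a0 ?expr0n ?add0r ?eqxx //.
  by rewrite -abE lerDl sqr_ge0.
have lb : ~~ (l %| b)%Z.
  apply/negP => /small b0; have := lnsq a; rewrite -abE b0 ?expr0n ?addr0 ?eqxx //.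
  by rewrite -abE lerDr sqr_ge0.
rewrite (eq_bigr (fun u => kron12_pair (gmul a b u) +
  kron12_pair (gmul a (- b) u))); last by case.
rewrite big_split /=.
rewrite -!sum_circle_gmul // -sum_circle_dvd /theta2.
rewrite [X in X + _ - _]big_mkcond [X in _ + X - _]big_mkcond.
rewrite [X in _ - X]big_mkcond.
rewrite -big_split -sumrB big_seq [RHS]big_seq; apply: eq_bigr => -[X Y].
rewrite mem_circle /= => /eqP XYE; rewrite mulNr.
have lP : (l %| a * X + b * Y)%Z || (l %| a * X - b * Y)%Z.
  rewrite -dvdz_prime_mul //.
  rewrite (_ : _ * _ = a ^+ 2 * (X ^+ 2 + Y ^+ 2) - l%:Z * Y ^+ 2); last first.
    by rewrite -abE; ring.
  apply: rpredB; last exact: dvdz_mulr.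
  by apply: dvdz_mull; rewrite XYE mulnCA PoszM dvdz_mulr.
have -> : (l %| X)%Z && (l %| Y)%Z =
    (l %| a * X + b * Y)%Z && (l %| a * X - b * Y)%Z.
  apply/andP/andP => [[lX lY] | [l1 l2]].
    by rewrite rpredD ?rpredB ?dvdz_mull.
  split.
    have : (l %| a * X)%Z.
      rewrite -dvdz_prime2 (_ : 2 * _ = a * X + b * Y + (a * X - b * Y)); last by ring.
      exact: rpredD.
    by rewrite dvdz_prime_mul // (negbTE la).
  have : (l %| b * Y)%Z.
    rewrite -dvdz_prime2 (_ : 2 * _ = a * X + b * Y - (a * X - b * Y)); last by ring.
    exact: rpredB.
  by rewrite dvdz_prime_mul // (negbTE lb).
move: lP; case: (l %| a * X + b * Y)%Z; case: (l %| a * X - b * Y)%Z => //= _;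
  by rewrite ?subr0 ?addr0 ?add0r ?addrK.
Qed.

Lemma theta2_pow_odd (j m : nat) (c : int) :
  (forall n, theta2 (l * n) = c * theta2_div n) -> ~~ (l %| m)%N ->
  theta2 (l ^ (2 * j).+1 * m) = 0.
Proof.
move=> rec lm; elim: j => [|j IH].
  by rewrite muln0 expn1 rec /theta2_div (negbTE lm) mulr0.
rewrite mulnS !expnS -!mulnA rec /theta2_div dvdn_mulr // mulKn ?prime_gt0 //.
by rewrite mulnA -expnS IH mulr0.
Qed.

Lemma theta2_pow_split (j m : nat) (e : int) : e ^+ 2 = 1 ->
  (forall n, theta2 (l * n) = 2 * e * theta2 n - theta2_div n) ->
  ~~ (l %| m)%N ->
  theta2 (l ^ j * m) = e ^+ j * j.+1%:Z * theta2 m.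
Proof.
move=> e2 rec lm.
suff : theta2 (l ^ j * m) = e ^+ j * j.+1%:Z * theta2 m /\
       theta2 (l ^ j.+1 * m) = e ^+ j.+1 * j.+2%:Z * theta2 m by case.
elim: j => [|j [IH0 IH1]].
  rewrite expn0 mul1n expr0 !mul1r expn1 rec /theta2_div (negbTE lm) subr0.
  by split=> //; rewrite expr1; ring.
split=> //; rewrite [(l ^ j.+2)%N]expnS -mulnA rec IH1 /theta2_div.
rewrite {1}[(l ^ j.+1)%N]expnS -mulnA dvdn_mulr //.
rewrite expnS -mulnA mulKn ?prime_gt0 // IH0.
have eK : e * (e * e ^+ j) = e ^+ j by rewrite mulrA -expr2 e2 mul1r.
rewrite !exprS eK; set t := theta2 m.
transitivity (2 * (e * (e * e ^+ j)) * j.+2%:Z * t - e ^+ j * j.+1%:Z * t).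
  by ring.
by rewrite eK !intS; ring.
Qed.

(** The exponent 2 l^v - 1 is odd, which kills theta2 in the cases c = 0 of the
    Hecke relation, and its successor is divisible by l^v. *)
Lemma dvdz_theta2_pow (v m : nat) : ~~ (l %| m)%N ->
  ((l ^ v)%N %| theta2 (l ^ (2 * l ^ v).-1 * m))%Z.
Proof.
move=> lm; have lv0 : (0 < l ^ v)%N by rewrite expn_gt0 prime_gt0.
have wE : ((2 * l ^ v).-1 = (2 * (l ^ v).-1).+1)%N by lia.
have zero c : (forall n, theta2 (l * n) = c * theta2_div n) ->
    ((l ^ v)%N %| theta2 (l ^ (2 * l ^ v).-1 * m))%Z.
  by move=> rec; rewrite wE (theta2_pow_odd _ rec) // dvdz0.
have [l41 | l43] : (l %% 4 = 1 \/ l %% 4 = 3)%N by case: l_mod12; lia.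
  have [a [b abE]] := prime_sum_two_squares l_prime l41.
  have [l1 | l5] : (l %% 12 = 1 \/ l %% 12 = 5)%N by case: l_mod12; lia.
    have [e e2 eP] := conj_sum_1mod12 abE l1.
    rewrite (@theta2_pow_split _ _ e) //.
      rewrite prednK ?muln_gt0 // PoszM mulrAC -!mulrA dvdz_mull // dvdz_mull //.
      by rewrite mulrC dvdz_mulr.
    move=> n; rewrite (hecke_split _ abE); congr (_ - _).
    by rewrite /theta2 mulr_sumr; apply: eq_bigr => -[x y] _; apply: eP.
  apply: (zero (-1)) => n; rewrite (hecke_split _ abE) big1 ?sub0r ?mulN1r //.
  by move=> u _; apply: conj_sum_5mod12 abE l5.
by apply: (zero 1) => n; rewrite hecke_inert // mul1r.
Qed.

End Hecke.

(** * Powers of the Euler series, l-adically *)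

(** For G = h^(l^(v+w)), j G_j is a coefficient of the derivative of G, which
    is a multiple of l^(v+w). *)
Lemma dvdz_coef_pow (l v w : nat) (h : {poly int}) (j : nat) : prime l ->
  ~~ (l ^ w.+1 %| j)%N -> ((l ^ v)%N %| (h ^+ (l ^ (v + w)))`_j)%Z.
Proof.
move=> l_prime lj; set G : {poly int} := h ^+ _.
case: j lj => [|i] li; first by rewrite dvdn0 in li.
have : ((l ^ (v + w))%N %| G`_(i.+1) * i.+1%:Z)%Z.
  apply/dvdzP; exists ((h^`() * h ^+ (l ^ (v + w)).-1)`_i).
  by rewrite -[i.+1%:Z]natz mulr_natr -coef_deriv deriv_exp coefMn -mulr_natr natz.
rewrite !dvdzE abszM /=; move: (absz G`_(i.+1)) => g.
have [-> // | g0] := posnP g.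
rewrite !pfactor_dvdn ?muln_gt0 ?g0 // in li *.
by rewrite lognM //; lia.
Qed.

Definition euler_trunc (N : nat) : {poly int} :=
  \poly_(i < N.+1) (euler_prod 1 i.+1)`_i.

Lemma euler_seriesE n : euler_series n = ((euler_prod 1 n.+1)`_n)%:~R.
Proof.
rewrite -[RHS]coef_map /= /euler_prod rmorph_prod /euler_series.
congr (nth 0 (polyseq _) _); apply: eq_bigr => k _;
  by rewrite rmorphB rmorph1 /= map_polyXn.
Qed.

Lemma series_powE alpha N : series_pow euler_series alpha N =
  \sum_(k < N.+1) gbinom alpha k * (((euler_trunc N - 1) ^+ k)`_N)%:~R.
Proof.
rewrite /series_pow coef_sum; apply: eq_bigr => k _; rewrite coefZ.
congr (_ * _); rewrite -coef_map /=.
rewrite rmorphXn rmorphB rmorph1 /=; congr (nth 0 (polyseq ((_ - _) ^+ _)) _).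
by apply/polyP => i; rewrite coef_map !coef_poly euler_seriesE; case: ifP.
Qed.

Lemma gbinom_nat (A k : nat) : gbinom A%:R k = 'C(A, k)%:R.
Proof.
have prodE : \prod_(i < k) (A%:R - i%:R) = (A ^_ k)%:R :> rat.
  elim: k => [|k IH]; first by rewrite big_ord0 ffactn0.
  rewrite big_ord_recr /= IH ffactnSr natrM.
  have [kA | Ak] := leqP k A; first by rewrite natrB.
  by rewrite ffact_small // !mul0r.
rewrite /gbinom prodE -bin_ffact natrM mulfK // pnatr_eq0 -lt0n; exact: fact_gt0.
Qed.

(** Binomial theorem: the terms (f - 1)^k with k > N, which the definition of
    the power omits, start in degree k. *)
Lemma series_pow_nat (A N : nat) :
  series_pow euler_series A%:R N = ((euler_trunc N ^+ A)`_N)%:~R.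
Proof.
rewrite series_powE; set u := euler_trunc N - 1.
have uX : exists u', u = u' * 'X.
  exists (\poly_(i < N) (euler_prod 1 i.+2)`_(i.+1)); apply/polyP => -[|i].
    rewrite coefMX /= coefB coef1 /euler_trunc coef_poly /euler_prod big_geq //.
    by rewrite coef1 subrr.
  by rewrite coefMX coefB /euler_trunc !coef_poly coef1 subr0.
have u_small k : (N < k)%N -> (u ^+ k)`_N = 0.
  by move=> Nk; case: uX => u' ->; rewrite exprMn coefMXn Nk.
rewrite -(subrK 1 (euler_trunc N)) -/u addrC exprDn coef_sum rmorph_sum /=.
pose F k : rat := 'C(A, k)%:R * ((u ^+ k)`_N)%:~R.
transitivity (\sum_(k < N.+1) F k).
  by apply: eq_bigr => k _; rewrite gbinom_nat.
transitivity (\sum_(k < A.+1) F k); last first.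
  apply: eq_bigr => k _; rewrite expr1n mul1r coefMn /F.
  by rewrite rmorphMn /= mulr_natl.
have widen n : (n = N \/ n = A) ->
    \sum_(k < n.+1) F k = \sum_(k < (maxn N A).+1) F k.
  move=> nE; rewrite (big_ord_widen (maxn N A).+1 F); last by lia.
  rewrite big_mkcond; apply: eq_bigr => k _; case: ltnP => // nk.
  rewrite /F; case: nE => nE; rewrite nE in nk.
    by rewrite u_small // mulr0.
  by rewrite bin_small // mul0r.
by rewrite !widen; auto.
Qed.

(** Membership in the ideal generated by l^m in the localization of the
    integers at l. *)
Definition padic_dvd (l m : nat) (x : rat) : Prop :=
  exists (d : nat) (z : int), ~~ (l %| d)%N /\ x * d%:R = (l ^ m)%:R * z%:~R.

Section Padic.

Variables (l : nat) (l_prime : prime l).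

Let ndvd1 : ~~ (l %| 1)%N.
Proof. by rewrite dvdn1; have := prime_gt1 l_prime; lia. Qed.

Lemma padic_dvd_int m (z : int) : ((l ^ m)%N %| z)%Z -> padic_dvd l m z%:~R.
Proof.
move=> /dvdzP [q ->]; exists 1%N, q; split=> //.
by rewrite mulr1 mulrC intrM.
Qed.

Lemma padic_dvdD m x y : padic_dvd l m x -> padic_dvd l m y ->
  padic_dvd l m (x + y).
Proof.
move=> [d [z [ld xE]]] [d' [z' [ld' yE]]].
exists (d * d')%N, (z * d'%:Z + z' * d%:Z).
split; first by rewrite Euclid_dvdM // negb_or ld.
rewrite natrM intrD !intrM -!pmulrn.
transitivity (x * d%:R * d'%:R + y * d'%:R * d%:R); first by ring.
by rewrite xE yE; ring.
Qed.

Lemma padic_dvdM m n x y : padic_dvd l m x -> padic_dvd l n y ->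
  padic_dvd l (m + n) (x * y).
Proof.
move=> [d [z [ld xE]]] [d' [z' [ld' yE]]].
exists (d * d')%N, (z * z').
split; first by rewrite Euclid_dvdM // negb_or ld.
rewrite natrM intrM expnD natrM.
transitivity ((x * d%:R) * (y * d'%:R)); first by ring.
by rewrite xE yE; ring.
Qed.

Lemma padic_dvd_leq m n x : (m <= n)%N -> padic_dvd l n x -> padic_dvd l m x.
Proof.
move=> mn [d [z [ld xE]]]; exists d, ((l ^ (n - m))%:Z * z); split=> //.
by rewrite xE intrM -pmulrn mulrA -natrM -expnD subnKC.
Qed.

Lemma padic_dvd_sum (I : Type) (r : seq I) m (F : I -> rat) :
  (forall i, padic_dvd l m (F i)) -> padic_dvd l m (\sum_(i <- r) F i).
Proof.
move=> h; elim/big_rec: _ => [|i x _ IH]; last exact: padic_dvdD.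
by rewrite -[0]/(0%:~R); apply: padic_dvd_int; apply: dvdz0.
Qed.

Lemma padic_dvd_div_nat m (k : nat) x : (0 < k)%N ->
  padic_dvd l (m + logn l k) x -> padic_dvd l m (x / k%:R).
Proof.
move=> k0 [d [z [ld xE]]].
have [u lu kE] := pfactor_coprime l_prime k0.
exists (d * u)%N, z; split.
  by rewrite Euclid_dvdM // negb_or ld -prime_coprime.
have k0' : k%:R != 0 :> rat by rewrite pnatr_eq0 -lt0n.
apply: (mulIf k0'); rewrite natrM mulrAC mulfVK //.
transitivity (x * d%:R * u%:R); first by ring.
have -> : k%:R = u%:R * (l ^ logn l k)%:R :> rat by rewrite -natrM -kE.
by rewrite xE expnD natrM; ring.
Qed.

Lemma le_ordq m x : padic_dvd l m x -> ((m%:Z)%:E <= ordq l x)%E.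
Proof.
move=> [d [z [ld xE]]]; rewrite /ordq; case: eqP => [_|/eqP x0].
  by rewrite leey.
rewrite lee_fin.
have den0 : (denq x)%:~R != 0 :> rat by rewrite intr_eq0 denq_neq0.
have eqz : numq x * d%:Z = (l ^ m)%:Z * z * denq x.
  apply/eqP; rewrite -(eqr_int rat) !intrM numqE -!pmulrn; apply/eqP.
  by rewrite mulrAC xE.
have d0 : (0 < d)%N by case: d ld {xE eqz} => //; rewrite dvdn0.
have num0 : (0 < `|numq x|)%N by rewrite absz_gt0 numq_eq0.
have dn0 : (0 < `|denq x|)%N by rewrite absz_gt0 denq_neq0.
have z0 : (0 < `|z|)%N.
  rewrite absz_gt0; apply: contraNneq x0 => z0; rewrite z0 mulr0 mul0r in eqz.
  by move/eqP: eqz; rewrite mulf_eq0 numq_eq0 => /orP [] // /eqP; lia.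
have := congr1 (fun n => logn l `|n|%N) eqz.
rewrite !abszM /= !lognM ?muln_gt0 ?expn_gt0 ?(prime_gt0 l_prime)
  ?z0 ?d0 ?num0 ?dn0 //.
rewrite pfactorK // [logn l d]lognE d0 l_prime (negbTE ld) /=; lia.
Qed.

Lemma ordq_int w (z : int) : ordq l z%:~R = (w%:Z)%:E ->
  ((l ^ w)%N %| z)%Z /\ ~~ ((l ^ w.+1)%N %| z)%Z.
Proof.
rewrite /ordq intr_eq0; case: eqP => // /eqP z0 [].
rewrite numq_int denq_int /= logn1 subr0 => -[wE].
have z0' : (0 < `|z|)%N by rewrite absz_gt0.
by rewrite !dvdzE /= !pfactor_dvdn // -wE leqnn ltnn.
Qed.

Lemma ordq_pos_fraction m x : (0 < m)%N -> ordq l x = (m%:Z)%:E ->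
  exists (s : int) (t : nat), ~~ (l %| t)%N /\ x * t%:R = (l ^ m)%:R * s%:~R.
Proof.
move=> m0; rewrite /ordq; case: eqP => // /eqP x0 [] ordE.
have num0 : (0 < `|numq x|)%N by rewrite absz_gt0 numq_eq0.
have dn0 : (0 < `|denq x|)%N by rewrite absz_gt0 denq_neq0.
have lnum : (0 < logn l `|numq x|)%N by lia.
have lden : ~~ (l %| `|denq x|)%N.
  apply/negP => ld.
  have : (l %| gcdn `|numq x| `|denq x|)%N.
    by rewrite dvdn_gcd ld andbT -(expn1 l) pfactor_dvdn.
  by rewrite (eqP (coprime_num_den x)); apply/negP.
have : ((l ^ m)%N %| numq x)%Z.
  by rewrite dvdzE /= pfactor_dvdn //; lia.
move=> /dvdzP [s sE]; exists s, `|denq x|%N; split=> //.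
have -> : (`|denq x|%N)%:R = (denq x)%:~R :> rat.
  by rewrite [LHS]pmulrn absz_denq.
by rewrite -numqE sE intrM mulrC.
Qed.

(** Density of the natural numbers in the l-adic integers. *)
Lemma nat_approx K (s : int) (t : nat) : ~~ (l %| t)%N ->
  exists B : nat, ((l ^ K)%N %| s - t%:Z * B%:Z)%Z.
Proof.
move=> lt.
have /coprimezP [[u q] /= uqE] : coprimez t (l ^ K)%N.
  by rewrite coprimezE /= coprime_sym coprimeXl // prime_coprime.
have lK0 : (l ^ K)%N%:Z != 0.
  by rewrite eqz_nat expn_eq0; have := prime_gt0 l_prime; lia.
exists `|(u * s %% (l ^ K)%N)%Z|%N.
rewrite gez0_abs ?modz_ge0 //.
set c := (u * s)%R; apply/dvdzP; exists (q * s + t%:Z * (c %/ (l ^ K)%N)%Z).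
have cE := divz_eq c (l ^ K)%N.
transitivity ((u * t%:Z + q * (l ^ K)%N%:Z) * s - t%:Z * (c %% (l ^ K)%N)%Z).
  by rewrite uqE mul1r.
transitivity (t%:Z * (c - (c %% (l ^ K)%N)%Z) + q * (l ^ K)%N%:Z * s).
  by rewrite /c; ring.
by rewrite {1}cE; ring.
Qed.

(** The product of the alpha - i is a polynomial in alpha with integer
    coefficients, so it preserves congruences; the division by k! loses the
    valuation of k!. *)
Lemma padic_dvd_gbinom_sub (v K : nat) (alpha : rat) (A k : nat) :
  padic_dvd l 0 alpha -> padic_dvd l K (alpha - A%:R) ->
  (v + logn l k`! <= K)%N -> padic_dvd l v (gbinom alpha k - gbinom A%:R k).
Proof.
move=> alpha_int alphaA vK; rewrite /gbinom -mulrBl.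
apply: padic_dvd_div_nat; first exact: fact_gt0.
apply: (padic_dvd_leq vK) => {vK}.
have subn_int x (i : nat) : padic_dvd l 0 x -> padic_dvd l 0 (x - i%:R).
  move=> x_int; apply: padic_dvdD => //; rewrite pmulrn -rmorphN.
  by apply: padic_dvd_int; apply: dvd1z.
have A_int : padic_dvd l 0 A%:R.
  by rewrite pmulrn; apply: padic_dvd_int; apply: dvd1z.
suff [] : padic_dvd l 0 (\prod_(i < k) (A%:R - i%:R)) /\
  padic_dvd l K (\prod_(i < k) (alpha - i%:R) - \prod_(i < k) (A%:R - i%:R)) by [].
elim: k => [|k [IHA IH]].
  rewrite !big_ord0 subrr -[1]/(1%:~R) -[0]/(0%:~R).
  by split; apply: padic_dvd_int; rewrite ?dvd1z ?dvdz0.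
rewrite !big_ord_recr /=; split.
  by rewrite -[0%N]addn0; apply: padic_dvdM => //; apply: subn_int.
set P := \prod_(i < k) _ in IH *; set Q := \prod_(i < k) _ in IHA IH *.
rewrite (_ : _ - _ = (P - Q) * (alpha - k%:R) + Q * (alpha - A%:R)); last by ring.
apply: padic_dvdD; last by rewrite -[K]add0n; apply: padic_dvdM.
by rewrite -[K]addn0; apply: padic_dvdM => //; apply: subn_int.
Qed.

Lemma padic_dvd_series_pow_sub (v K : nat) (alpha : rat) (A N : nat) :
  padic_dvd l 0 alpha -> padic_dvd l K (alpha - A%:R) ->
  (v + logn l N`! <= K)%N ->
  padic_dvd l v (series_pow euler_series alpha N - series_pow euler_series A%:R N).
Proof.
move=> alpha_int alphaA vK; rewrite !series_powE -sumrB.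
apply: padic_dvd_sum => k; rewrite -mulrBl -[v]addn0.
apply: padic_dvdM; last by apply: padic_dvd_int; apply: dvd1z.
apply: padic_dvd_gbinom_sub alpha_int alphaA _.
apply: leq_trans vK; rewrite leq_add2l dvdn_leq_log ?fact_gt0 //.
by rewrite -(bin_fact (leq_ord k)) mulnCA dvdn_mulr.
Qed.

Hypothesis l_gt3 : (3 < l)%N.

Lemma dvdz_coef_euler_sqr (v M N : nat) : (M <= N)%N ->
  ((l ^ (2 * l ^ v).-1)%N %| (12 * M).+1)%N ->
  ~~ ((l ^ (2 * l ^ v))%N %| (12 * M).+1)%N ->
  ((l ^ v)%N %| ((euler_trunc N) ^+ 2)`_M)%Z.
Proof.
move=> MN /dvdnP [m mE] nd.
have lm : ~~ (l %| m)%N.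
  apply: contra nd => /dvdnP [m' m'E]; rewrite mE m'E -mulnA -expnS.
  have lv : (0 < l ^ v)%N by rewrite expn_gt0 prime_gt0.
  by rewrite prednK ?dvdn_mull //; lia.
have -> : (euler_trunc N ^+ 2)`_M = (theta_trunc N ^+ 2)`_M.
  rewrite !expr2 !coefM; apply: eq_bigr => i _.
  have iM : (i <= M)%N := leq_ord i.
  have iN := leq_trans iM MN; have MiN := leq_trans (leq_subr i M) MN.
  rewrite !coef_poly !ltnS iN MiN.
  by rewrite (pentagonal iN) (pentagonal MiN).
have : ((l ^ v)%N %| (theta_trunc N ^+ 2)`_M * 4)%Z.
  rewrite -[4]/(4%:R) mulr_natr coef_theta_trunc_sqr // mE mulnC.
  exact: dvdz_theta2_pow.
rewrite mulrC Gauss_dvdzr // coprimezE /= coprimeXl // prime_coprime //.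
apply/negP => l4; have : (l %| 2 ^ 2)%N := l4.
by rewrite Euclid_dvdX // andbT => /dvdn_leq; lia.
Qed.

(** Expand the product of the square and of the l^(v+w)-th power. The terms
    not killed by the second factor have 12 M + 1 = 12 N + 1 mod l^(w+1),
    where M is the degree in the square. *)
Lemma dvdz_coef_euler_pow (v w B N : nat) :
  w = (2 * l ^ v).-1 ->
  (l ^ w %| (12 * N).+1)%N -> ~~ (l ^ w.+1 %| (12 * N).+1)%N ->
  ((l ^ v)%N %| (euler_trunc N ^+ (2 + l ^ (v + w) * B))`_N)%Z.
Proof.
move=> wE lN nlN; have lv : (0 < l ^ v)%N by rewrite expn_gt0 prime_gt0.
have wS : (w.+1 = 2 * l ^ v)%N by lia.
rewrite exprD [(_ * B)%N]mulnC exprM coefM.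
apply: rpred_sum => j _; have jN : (j <= N)%N := leq_ord j.
have [lj | nlj] := boolP (l ^ w.+1 %| N - j)%N; last first.
  by apply: dvdz_mull; apply: dvdz_coef_pow.
apply: dvdz_mulr; apply: dvdz_coef_euler_sqr => //.
  rewrite -wE -(dvdn_addr _ (_ : l ^ w %| 12 * (N - j))%N).
    by rewrite (_ : _ + _ = (12 * N).+1)%N //; lia.
  by apply: dvdn_mull; apply: dvdn_trans lj; apply: dvdn_exp2l.
rewrite -wS -(dvdn_addr _ (_ : l ^ w.+1 %| 12 * (N - j))%N).
  by rewrite (_ : _ + _ = (12 * N).+1)%N //; lia.
exact: dvdn_mull.
Qed.

End Padic.

Theorem theorem4 (l v : nat) (l_prime : prime l) (v_gt0 : (0 < v)%N) :
  exists w : nat, (0 < w)%N /\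
    forall (alpha : rat) (r : int),
      ordq l (alpha - 2) = ((v + w)%N%:Z)%:E ->
      ordq l (12 * r + 1)%:~R = (w%:Z)%:E ->
      forall n : int,
        ((v%:Z)%:E <= ordq l (p_ alpha ((l ^ w.+1)%N%:Z * n + r)))%E.
Proof.
have l0 := prime_gt0 l_prime.
have lv : (0 < l ^ v)%N by rewrite expn_gt0 l0.
pose w := (2 * l ^ v).-1; have w0 : (0 < w)%N by rewrite /w; lia.
exists w; split=> // alpha r ord_alpha /(ordq_int l_prime) [r_dvd r_ndvd] n.
have l12r : (l %| 12 * r + 1)%Z.
  by apply: dvdz_trans r_dvd; rewrite dvdzE /= dvdn_exp.
have l_gt3 : (3 < l)%N.
  rewrite ltnNge; apply/negP => l3.
  have : l = 2%N \/ l = 3%N by have := prime_gt1 l_prime; lia.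
  by case=> lE; rewrite lE in l12r; lia.
(* If the exponent N is natural, 12 N + 1 = 12 r + 1 mod l^(w+1). *)
set idx := _ + r.
case idxE : idx => [N|N]; last by rewrite /= /ordq eqxx leey.
have N_dvd e : (e <= w.+1)%N ->
    (l ^ e %| (12 * N).+1)%N = ((l ^ e)%N %| 12 * r + 1)%Z.
  move=> ew; have -> : (l ^ e %| (12 * N).+1)%N = ((l ^ e)%N %| (12 * N).+1%:Z)%Z.
    by rewrite dvdzE.
  rewrite (_ : (12 * N).+1%:Z = (l ^ w.+1)%N%:Z * (12 * n) + (12 * r + 1)).
    by rewrite rpredDl // dvdz_mulr // dvdzE /= dvdn_exp2l.
  have -> : (12 * N).+1%:Z = 12 * N%:Z + 1 by lia.
  by rewrite -idxE /idx; ring.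
rewrite [p_ _ _]/=; apply: (le_ordq l_prime).
(* alpha = 2 + l^(v+w) s/t; the precision log_l N! makes up for the
   denominators of the binomial coefficients up to degree N. *)
have [s [t [lt alphaE]]] := ordq_pos_fraction l_prime (ltn_addl v w0) ord_alpha.
have [B B_approx] := nat_approx l_prime (v + logn l N`!) s lt.
pose A := (2 + l ^ (v + w) * B)%N.
have alpha_int : padic_dvd l 0 alpha.
  rewrite -(subrK 2 alpha); apply: padic_dvdD => //.
    by apply: (padic_dvd_leq (leq0n (v + w))); exists t, s.
  by rewrite -[2]/(2%:~R); apply: padic_dvd_int => //; apply: dvd1z.
have alphaA : padic_dvd l (v + logn l N`!) (alpha - A%:R).
  apply: (@padic_dvd_leq l _ ((v + w) + (v + logn l N`!))); first by lia.
  case/dvdzP: B_approx => q qE; exists t, q; split=> //.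
  have qE' : s%:~R - t%:R * B%:R = q%:~R * (l ^ (v + logn l N`!))%:R :> rat.
    by have := congr1 (fun z : int => z%:~R : rat) qE; rewrite rmorphB !rmorphM.
  rewrite /A natrD natrM.
  transitivity ((alpha - 2) * t%:R - (l ^ (v + w))%:R * (t%:R * B%:R)).
    by ring.
  by rewrite alphaE -mulrBr qE' [in RHS]expnD natrM; ring.
rewrite -(subrK (series_pow euler_series A%:R N) (series_pow _ _ _)).
apply: padic_dvdD => //.
  exact: padic_dvd_series_pow_sub alpha_int alphaA (leqnn _).
rewrite series_pow_nat; apply: padic_dvd_int => //.
by apply: dvdz_coef_euler_pow => //; rewrite N_dvd.
Qed.
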